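(* For an associative unital ring $R$, the following conditions are equivalent: (1) $R$ is a clean $UJ$-ring with nil Jacobson radical $J(R)$; (2) $R/J(R)$ is a Boolean ring and $J(R)$ is nil; (3) $R$ is a nil clean $UJ$-ring; (4) $R$ is a conjugate nil clean $UJ$-ring; (5) $R$ is a conjugate nil clean ring and $N(R)$ is an ideal of $R$; (6) $R/J(R)$ is a Boolean ring and $R$ is a $UU$-ring.
   Context: $U(R)$ is the group of units, $J(R)$ the Jacobson radical and $N(R)$ the set of all nilpotent elements of $R$. $R$ is a $UJ$-ring if $U(R)=1+J(R)$, and a $UU$-ring if $U(R)=1+N(R)$. $R$ is clean if every element is a sum $e+u$ of an idempotent $e$ and a unit $u$; $R$ is nil clean if every element is a sum $e+n$ of an idempotent $e$ and a nilpotent element $n$ (in neither case are the summands required to commute). $R$ is conjugate nil clean if it is nil clean and, whenever $e+n=f+m$ with $e,f$ idempotents and $n,m$ nilpotent elements of $R$, the idempotents $e$ and $f$ are conjugate, i.e. $f=u^{-1}eu$ for some $u\in U(R)$. A ring is Boolean if all its elements are idempotent; an ideal is nil if all its elements are nilpotent. *)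

(* Defs.v *)
From HB Require Import structures.
From mathcomp Require Import all_boot all_algebra.
From mathcomp Require Import boolp classical_sets.

Set Implicit Arguments.
Unset Strict Implicit.
Unset Printing Implicit Defensive.

Import GRing.Theory.
Local Open Scope ring_scope.
Local Open Scope classical_set_scope.
Local Open Scope quotient_scope.

(* Rings are [pzRingType]s, i.e. associative unital rings, the zero ring       *)
(* included. [GRing.unit] needs a nontrivial ring with a decidable unit         *)
(* predicate, so units are defined here as two-sided invertible elements.       *)

Section Notions.
Variable R : pzRingType.
Implicit Types (I M : set R) (e f n m u v x y : R).

Definition units : set R := [set u | exists v, u * v = 1 /\ v * u = 1].

Definition nilpotents : set R := [set x | exists k : nat, x ^+ k = 0].

Definition idempotents : set R := [set e | e * e = e].

Definition left_ideal I : Prop :=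
  [/\ I 0, forall x y, I x -> I y -> I (x - y) &
      forall a x, I x -> I (a * x)].

Definition two_sided_ideal I : Prop :=
  left_ideal I /\ forall a x, I x -> I (x * a).

Definition maximal_left_ideal M : Prop :=
  [/\ left_ideal M, M <> setT &
      forall I, left_ideal I -> M `<=` I -> I <> setT -> I = M].

(* In the zero ring the intersection is over the empty family: J(R) = R. *)
Definition jacobson : set R := \bigcap_(M in maximal_left_ideal) M.

Definition nil_set I : Prop := I `<=` nilpotents.

Definition UJ_ring : Prop := units = [set 1 + j | j in jacobson].

Definition UU_ring : Prop := units = [set 1 + n | n in nilpotents].

Definition clean : Prop :=
  forall x, exists e u, [/\ idempotents e, units u & x = e + u].

Definition nil_clean : Prop :=
  forall x, exists e n, [/\ idempotents e, nilpotents n & x = e + n].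

(* [v] is the inverse of [u], so the last equation is f = u^-1 e u. *)
Definition conjugate e f : Prop :=
  exists u v, [/\ u * v = 1, v * u = 1 & f = v * e * u].

Definition conjugate_nil_clean : Prop :=
  nil_clean /\
  forall e f n m, idempotents e -> idempotents f ->
    nilpotents n -> nilpotents m -> e + n = f + m -> conjugate e f.

Definition boolean_ring : Prop := forall x, idempotents x.

End Notions.

Arguments units : clear implicits.
Arguments nilpotents : clear implicits.
Arguments idempotents : clear implicits.
Arguments jacobson : clear implicits.

(* The library only builds ring quotients of commutative rings by proper       *)
(* ideals. Its additive quotient [Quotient.quot] applies to J(R), and the      *)
(* multiplication is added below, J(R) being two-sided.                        *)

Section JacobsonIdeal.
Variable R : pzRingType.

Lemma jacobson_left_ideal : left_ideal (jacobson R).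
Proof.
split=> [M [[]]//|x y Jx Jy M mM|a x Jx M mM]; case: (mM) => -[_ MB MM] _ _.
- by apply: MB; [exact: Jx|exact: Jy].
- by apply: MM; exact: Jx.
Qed.

Lemma left_idealD (I : set R) x y : left_ideal I -> I x -> I y -> I (x + y).
Proof.
by case=> I0 IB _ Ix Iy; rewrite -[y]opprK -[- y]sub0r; apply/IB/IB.
Qed.

Lemma left_ideal1 (I : set R) : left_ideal I -> I 1 -> I = setT.
Proof.
case=> _ _ IM I1; apply/seteqP; split=> // x _.
by rewrite -[x]mulr1; apply: IM.
Qed.

Lemma maximal_left_ideal_transporter (M : set R) r :
  maximal_left_ideal M -> ~ M r -> maximal_left_ideal [set y | M (y * r)].
Proof.
move=> [lM _ maxM] Mr; have [M0 MB MM] := lM.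
have lT : left_ideal [set y | M (y * r)].
  split=> [|x y|a x] /=; first by rewrite mul0r.
  - by rewrite mulrBl; exact: MB.
  - by rewrite -mulrA; exact: MM.
split=> // [/seteqP[_ /(_ 1 I)] /=|L lL TL LT]; first by rewrite mul1r.
have [L0 LB LM] := lL.
pose S := [set x | exists l m, [/\ L l, M m & x = l * r + m]].
have lS : left_ideal S.
  split=> [|_ _ [l [m [Ll Mm ->]]] [l' [m' [Ll' Mm' ->]]]|a _ [l [m [Ll Mm ->]]]].
  - by exists 0, 0; rewrite mul0r addr0.
  - exists (l - l'), (m - m'); split; [exact: LB|exact: MB|].
    by rewrite mulrBl opprD addrACA.
  - by exists (a * l), (a * m); split; [exact: LM|exact: MM|rewrite mulrDr mulrA].
have MS : M `<=` S by move=> m Mm; exists 0, m; rewrite mul0r add0r.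
have [ST|SNT] := pselect (S = setT).
  have [l [m [Ll Mm rE]]] : S r by rewrite ST.
  case: LT; apply: left_ideal1 => //; rewrite -[1](subrK l).
  apply: left_idealD => //; apply: TL => /=.
  by rewrite mulrBl mul1r {1}rE addrC addKr.
apply/seteqP; split=> // l Ll /=.
by rewrite -(maxM _ lS MS SNT); exists l, 0; rewrite addr0.
Qed.

Lemma jacobson_two_sided : two_sided_ideal (jacobson R).
Proof.
split=> [|a x Jx M mM]; first exact: jacobson_left_ideal.
have [Ma|Ma] := pselect (M a); first by case: mM => -[_ _ MM] _ _; exact: MM.
exact: (Jx _ (maximal_left_ideal_transporter mM Ma)).
Qed.

Definition jacobson_pred : {pred R} := fun x => `[< jacobson R x >].

Lemma jacobson_zmod_closed : zmod_closed jacobson_pred.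
Proof.
have [J0 JB _] := jacobson_left_ideal.
by split=> [|x y /asboolP Jx /asboolP Jy]; apply/asboolP => //; exact: JB.
Qed.

HB.instance Definition _ :=
  GRing.isZmodClosed.Build R jacobson_pred jacobson_zmod_closed.

Definition jacobson_quot := Quotient.quot jacobson_pred.

HB.instance Definition _ :=
  EqQuotient.copy jacobson_quot (Quotient.quot jacobson_pred).
HB.instance Definition _ :=
  GRing.Zmodule.copy jacobson_quot (Quotient.quot jacobson_pred).

Definition jacobson_proj (x : R) : jacobson_quot := \pi x.

Lemma jacobson_projK : cancel (@repr R jacobson_quot) jacobson_proj.
Proof. exact: reprK. Qed.

Lemma jacobson_proj_eq (x y : R) :
  jacobson_proj x = jacobson_proj y <-> jacobson R (x - y).
Proof.
split=> [/eqP|Jxy].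
  by rewrite -Quotient.idealrBE => /asboolP.
by apply/eqP; rewrite -Quotient.idealrBE; apply/asboolP.
Qed.

Definition jacobson_quot_one : jacobson_quot := jacobson_proj 1.

Definition jacobson_quot_mul (x y : jacobson_quot) : jacobson_quot :=
  jacobson_proj (repr x * repr y).

Lemma jacobson_proj_mul :
  {morph jacobson_proj : x y / x * y >-> jacobson_quot_mul x y}.
Proof.
move=> x y; apply/jacobson_proj_eq.
set x' := repr (jacobson_proj x); set y' := repr (jacobson_proj y).
have Jx : jacobson R (x - x') by apply/jacobson_proj_eq; rewrite jacobson_projK.
have Jy : jacobson R (y - y') by apply/jacobson_proj_eq; rewrite jacobson_projK.
have -> : x * y - x' * y' = (x - x') * y + x' * (y - y').
  by rewrite mulrBl mulrBr addrA subrK.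
have [lJ JM] := jacobson_two_sided; have [_ _ MJ] := lJ.
apply: (left_idealD lJ); [exact: JM|exact: MJ].
Qed.

Lemma jacobson_proj_add : {morph jacobson_proj : x y / x + y}.
Proof. by move=> x y; rewrite /jacobson_proj; exact: Quotient.pi_add. Qed.

Lemma jacobson_quot_mulA : associative jacobson_quot_mul.
Proof.
move=> x y z; rewrite -[x]jacobson_projK -[y]jacobson_projK -[z]jacobson_projK.
by rewrite -!jacobson_proj_mul mulrA.
Qed.

Lemma jacobson_quot_mul1l : left_id jacobson_quot_one jacobson_quot_mul.
Proof.
by move=> x; rewrite -[x]jacobson_projK -jacobson_proj_mul mul1r.
Qed.

Lemma jacobson_quot_mul1r : right_id jacobson_quot_one jacobson_quot_mul.
Proof.
by move=> x; rewrite -[x]jacobson_projK -jacobson_proj_mul mulr1.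
Qed.

Lemma jacobson_quot_mulDl : left_distributive jacobson_quot_mul +%R.
Proof.
move=> x y z; rewrite -[x]jacobson_projK -[y]jacobson_projK -[z]jacobson_projK.
by rewrite -jacobson_proj_add -!jacobson_proj_mul -jacobson_proj_add mulrDl.
Qed.

Lemma jacobson_quot_mulDr : right_distributive jacobson_quot_mul +%R.
Proof.
move=> x y z; rewrite -[x]jacobson_projK -[y]jacobson_projK -[z]jacobson_projK.
by rewrite -jacobson_proj_add -!jacobson_proj_mul -jacobson_proj_add mulrDr.
Qed.

HB.instance Definition _ := GRing.Zmodule_isPzRing.Build jacobson_quot
  jacobson_quot_mulA jacobson_quot_mul1l jacobson_quot_mul1r
  jacobson_quot_mulDl jacobson_quot_mulDr.

Lemma jacobson_proj_zmod_morphism : zmod_morphism jacobson_proj.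
Proof.
move=> x y; apply/eqP.
by rewrite eq_sym subr_eq -jacobson_proj_add subrK.
Qed.

Lemma jacobson_proj_monoid_morphism : monoid_morphism jacobson_proj.
Proof. by split=> // x y; exact: jacobson_proj_mul. Qed.

HB.instance Definition _ := GRing.isZmodMorphism.Build R jacobson_quot
  jacobson_proj jacobson_proj_zmod_morphism.
HB.instance Definition _ := GRing.isMonoidMorphism.Build R jacobson_quot
  jacobson_proj jacobson_proj_monoid_morphism.

End JacobsonIdeal.

(* Main.v *)
Require Import Defs.
From mathcomp Require Import all_boot all_algebra.
From mathcomp Require Import boolp classical_sets.

(** Write [pr] for the projection onto R/J(R), and call R good when R/J(R) is
    Boolean and J(R) is nil; all six conditions say that R is good.

    A unit of a Boolean ring is 1, and the elements over 1 are always units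
    ([unit_of_jacobson_proj1]); so a Boolean quotient forces U(R) = 1 + J(R)
    ([UJ_of_boolean_quot]).  If moreover J(R) is nil, idempotents lift along
    [pr] ([idempotent_lift]), and every x is a lift of [pr x] plus an element
    of J(R); this is nil cleanness, and also cleanness when applied to x - 1.

    Conversely, in a nil clean ring an element of J(R) is e + n with n
    nilpotent, and e vanishes as soon as nilpotents lie in J(R), because the
    only idempotent of J(R) is 0.  Then J(R) = N(R)
    ([jacobson_eq_nilpotents]), and x = e + n exhibits [pr x] as the
    idempotent [pr e], so R is good.  The inclusion of N(R) in J(R) follows
    from UJ since 1 + n is a unit for n nilpotent, and it holds whenever N(R)
    is an ideal.  A clean UJ ring has a Boolean quotient because its units
    project to 1, in particular -1 does, so that [pr x] = e + 1 in
    characteristic 2.  Finally, when the quotient is Boolean, UU reads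
    1 + J(R) = 1 + N(R), so J(R) is nil ([nil_jacobson_of_UU]).

    Conjugacy comes for free: if e + n = f + m with n, m in J(R) then e and f
    have the same projection, and idempotents with the same projection are
    conjugate ([conjugate_of_jacobson_proj_eq]). *)

Set Implicit Arguments.
Unset Strict Implicit.
Unset Printing Implicit Defensive.

Import GRing.Theory.
Local Open Scope ring_scope.
Local Open Scope classical_set_scope.

(** * The Jacobson radical and units *)

Section Radical.
Variable R : pzRingType.
Implicit Types (I M : set R) (e f j n p q u v x y : R).

Lemma maximal_left_ideal_exists I :
  left_ideal I -> ~ I 1 -> exists2 M, maximal_left_ideal M & I `<=` M.
Proof.
move=> lI I1.
(* Zorn is applied to the sets A for which A `|` I is a proper left ideal,
   rather than to the ideals containing I, so that the empty chain has an
   upper bound. *)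
pose P A := left_ideal (A `|` I) /\ ~ (A `|` I) 1.
have [|A [[lA A1] maxA]] := @Zorn_bigcup R P.
  move=> F FP Ftot; have [I0 IB IM] := lI.
  pose U := \bigcup_(X in F) X `|` I.
  have inU X x : F X -> (X `|` I) x -> U x.
    by move=> FX [Xx|Ix]; [left; exists X|right].
  have outU x : U x -> I x \/ exists2 X, F X & (X `|` I) x.
    by case=> [[X FX Xx]|]; [right; exists X => //; left|left].
  split; last by move=> /outU[//|[X FX X1]]; have [_] := FP X FX; apply.
  split=> [|x y /outU Ux /outU Uy|a x /outU[Ix|[X FX Xx]]]; first by right.
  - case: Ux => [Ix|[X FX Xx]]; case: Uy => [Iy|[Y FY Yy]].
    + by right; exact: IB.
    + have [[_ YB _] _] := FP Y FY; apply: (inU Y) => //.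
      by apply: YB => //; right.
    + have [[_ XB _] _] := FP X FX; apply: (inU X) => //.
      by apply: XB => //; right.
    + have [XY|YX] := Ftot X Y FX FY.
        have [[_ YB _] _] := FP Y FY; apply: (inU Y) => //; apply: YB => //.
        by case: Xx => [/XY|]; [left|right].
      have [[_ XB _] _] := FP X FX; apply: (inU X) => //; apply: XB => //.
      by case: Yy => [/YX|]; [left|right].
  - by right; exact: IM.
  - by have [[_ _ XM] _] := FP X FX; apply: (inU X) => //; exact: XM.
exists (A `|` I); last by move=> x Ix; right.
split=> // [AT|L lL AL LT]; first by apply: A1; rewrite AT.
apply: contrapT => LA; apply: (maxA L).
  split=> [x Ax|LsubA]; first by apply: AL; left.
  by apply: LA; apply/seteqP; split=> // x /LsubA; left.
have LI : L `|` I = L by apply/setUidPl => x Ix; apply: AL; right.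
by rewrite /P LI; split=> // /(left_ideal1 lL)/LT.
Qed.

(** Otherwise a maximal left ideal contains R (1 - j); it also contains j, hence
    1. *)
Lemma left_inverse_of_1subJ j : jacobson R j -> exists v, v * (1 - j) = 1.
Proof.
move=> Jj; pose I := [set y | exists v, y = v * (1 - j)].
have lI : left_ideal I.
  split=> [|_ _ [v ->] [w ->]|a _ [v ->]].
  - by exists 0; rewrite mul0r.
  - by exists (v - w); rewrite mulrBl.
  - by exists (a * v); rewrite mulrA.
apply: contrapT => noinv; have I1 : ~ I 1 by case=> v vE; apply: noinv; exists v.
have [M mM IM] := maximal_left_ideal_exists lI I1.
have [lM MT _] := mM; apply: MT; apply: left_ideal1 => //.
rewrite -(subrK j 1); apply: left_idealD => //; last exact: Jj.
by apply: IM; exists 1; rewrite mul1r.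
Qed.

Lemma unit_1subJ j : jacobson R j -> units R (1 - j).
Proof.
move=> Jj; have [v vE] := left_inverse_of_1subJ Jj.
have [[[_ JB JM] _] J0] : two_sided_ideal (jacobson R) /\ jacobson R 0.
  by split; [exact: jacobson_two_sided|case: (jacobson_left_ideal R)].
(* v = 1 + v j is again congruent to 1, so v has a left inverse too. *)
have [w wE] : exists w, w * v = 1.
  have [w wE] : exists w, w * (1 - (- (v * j))) = 1.
    by apply: left_inverse_of_1subJ; rewrite -sub0r; apply: JB => //; exact: JM.
  by exists w; rewrite -[RHS]wE opprK -[in RHS]vE mulrBr mulr1 subrK.
suff wj : w = 1 - j by exists v; rewrite -{1}wj.
by rewrite -[LHS]mulr1 -[in LHS]vE mulrA wE mul1r.
Qed.

Lemma unit_1addn n : nilpotents R n -> units R (1 + n).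
Proof.
case=> k nk0; exists (\sum_(i < k) (- n) ^+ i).
have H : 1 = (1 + n) * \sum_(i < k) (- n) ^+ i.
  apply: oppr_inj; rewrite -mulNr opprD [- 1 - n]addrC -subrX1.
  by rewrite exprNn nk0 mulr0 sub0r.
split=> //; rewrite {2}H; apply: commr_sym; apply: commr_sum => i _.
by apply/commrX/commrN/commr_sym/commrD => //; exact: commr1.
Qed.

(** If x misses a maximal left ideal M, some r x is congruent to 1 modulo M;
    but then the unit 1 - r x lies in M. *)
Lemma left_ideal_sub_jacobson I :
  left_ideal I -> (forall x, I x -> units R (1 - x)) -> I `<=` jacobson R.
Proof.
move=> lI Iu x Ix M mM; have [lM MT maxM] := mM.
apply: contrapT => Mx; have [I0 IB IM] := lI; have [M0 MB MM] := lM.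
pose S := [set y | exists m i, [/\ M m, I i & y = m + i]].
have lS : left_ideal S.
  split=> [|_ _ [m [i [Mm Ii ->]]] [m' [i' [Mm' Ii' ->]]]|a _ [m [i [Mm Ii ->]]]].
  - by exists 0, 0; rewrite addr0.
  - exists (m - m'), (i - i'); split; [exact: MB|exact: IB|].
    by rewrite opprD addrACA.
  - by exists (a * m), (a * i); split; [exact: MM|exact: IM|rewrite mulrDr].
have MS : M `<=` S by move=> m Mm; exists m, 0; rewrite addr0.
have [ST|ST] := pselect (S = setT).
  have [m [i [Mm Ii mi1]]] : S 1 by rewrite ST.
  apply: MT; apply: left_ideal1 => //; have [v [_ <-]] := Iu i Ii.
  by rewrite mi1 addrK; exact: MM.
by apply: Mx; rewrite -(maxM S lS MS ST); exists 0, x; rewrite add0r.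
Qed.

(** The unit 1 - e is annihilated by e. *)
Lemma jacobson_idempotent0 e : idempotents R e -> jacobson R e -> e = 0.
Proof.
move=> ee /unit_1subJ[v [_ v1]].
by rewrite -[e]mul1r -v1 -mulrA mulrBl mul1r ee subrr mulr0.
Qed.

(** * Reduction modulo the radical *)

Local Notation pr := (@jacobson_proj R).

Let pr1 : pr 1 = 1. Proof. exact: rmorph1. Qed.
Let prN x : pr (- x) = - pr x. Proof. exact: rmorphN. Qed.
Let prD x y : pr (x + y) = pr x + pr y. Proof. exact: rmorphD. Qed.
Let prB x y : pr (x - y) = pr x - pr y. Proof. exact: rmorphB. Qed.
Let prM x y : pr (x * y) = pr x * pr y. Proof. exact: rmorphM. Qed.

Lemma jacobson_proj_eq0 x : pr x = 0 <-> jacobson R x.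
Proof. by rewrite -{2}[x]subr0 -jacobson_proj_eq raddf0. Qed.

Lemma unit_of_jacobson_proj1 u : pr u = 1 -> units R u.
Proof.
move=> u1; rewrite -[u](subKr 1); apply: unit_1subJ.
by apply/jacobson_proj_eq0; rewrite prB pr1 u1 subrr.
Qed.

Lemma UJ_ringP : UJ_ring R <-> forall u, units R u -> pr u = 1.
Proof.
split=> [UJ u|U1].
  rewrite UJ => -[j /jacobson_proj_eq0 j0 <-].
  by rewrite prD pr1 j0 addr0.
apply/seteqP; split=> [u Uu|_ [j /jacobson_proj_eq0 j0 <-]].
  exists (u - 1); last by rewrite addrC subrK.
  by apply/jacobson_proj_eq0; rewrite prB pr1 U1 // subrr.
by apply: unit_of_jacobson_proj1; rewrite prD pr1 j0 addr0.
Qed.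

Lemma boolean_quotP :
  boolean_ring (jacobson_quot R) <-> forall x, pr x * pr x = pr x.
Proof.
by split=> [B x|B z]; [exact: B|rewrite -[z]jacobson_projK; exact: B].
Qed.

Lemma UJ_of_boolean_quot : boolean_ring (jacobson_quot R) -> UJ_ring R.
Proof.
move=> B; apply/UJ_ringP => u [v [uv1 _]].
by rewrite -[pr u]mulr1 -pr1 -uv1 prM mulrA (B (pr u)).
Qed.

(** Conjugation by u = e f + (1 - e)(1 - f) carries e to f: both e u and u f
    are e f, and u projects to 1. *)
Lemma conjugate_of_jacobson_proj_eq e f :
  idempotents R e -> idempotents R f -> pr e = pr f -> conjugate e f.
Proof.
move=> ee ff ef; pose u := e * f + (1 - e) * (1 - f).
have [v [uv vu]] : units R u.
  apply: unit_of_jacobson_proj1.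
  rewrite prD !prM !prB pr1 ef -prM ff mulrBr mulr1.
  by rewrite mulrBl mul1r -prM ff subrr subr0 addrC subrK.
exists u, v; split=> //.
have eu : e * u = e * f.
  by rewrite mulrDr !mulrA ee (mulrBr e 1 e) mulr1 ee subrr mul0r addr0.
have uf : u * f = e * f.
  by rewrite mulrDl -!mulrA ff (mulrBl f 1 f) mul1r ff subrr mulr0 addr0.
by rewrite -mulrA eu -uf mulrA vu mul1r.
Qed.

(** p (p + q) = p^2 = (p + q) p, so v commutes with p and (v p)^2 = v p. *)
Lemma idempotent_of_orthogonal p q v :
    p * q = 0 -> q * p = 0 -> (p + q) * v = 1 -> v * (p + q) = 1 ->
  idempotents R (v * p).
Proof.
move=> pq qp sv vs.
have ps : p * (p + q) = p * p by rewrite mulrDr pq addr0.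
have sp : (p + q) * p = p * p by rewrite mulrDl qp addr0.
have pv : p * v = v * p.
  by rewrite -[LHS]mul1r -vs -mulrA (mulrA (p + q)) sp -ps -!mulrA sv mulr1.
by rewrite /idempotents /= -mulrA (mulrA p) pv -(mulrA v p) -sp (mulrA v (p + q)) vs mul1r.
Qed.

(** If (x (1 - x))^k = 0 with k > 0, then p = x^k and q = (1 - x)^k are
    orthogonal, and in the Boolean quotient p + q projects to
    [pr x] + (1 - [pr x]) = 1; the idempotent they define is the lift. *)
Lemma idempotent_lift x :
    boolean_ring (jacobson_quot R) -> nil_set (jacobson R) ->
  exists2 e, idempotents R e & pr e = pr x.
Proof.
move=> B JN.
have prX y k : pr (y ^+ k.+1) = pr y.
  elim: k => [|k IH]; first by rewrite expr1.
  by rewrite exprS prM IH (B (pr y)).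
have xC : GRing.comm x (1 - x) by apply: commrB => //; exact: commr1.
have [k xk] : nilpotents R (x * (1 - x)).
  apply/JN/jacobson_proj_eq0.
  by rewrite prM prB pr1 mulrBr mulr1 (B (pr x)) subrr.
pose p := x ^+ k.+1; pose q := (1 - x) ^+ k.+1.
have pq : p * q = 0 by rewrite /p /q -exprMn_comm // exprS xk mulr0.
have qp : q * p = 0.
  by rewrite /p /q -exprMn_comm; [rewrite -xC exprS xk mulr0|exact: commr_sym].
have s1 : pr (p + q) = 1.
  by rewrite prD !prX prB pr1 addrC subrK.
have [v [sv vs]] := unit_of_jacobson_proj1 s1.
exists (v * p); first exact: idempotent_of_orthogonal sv vs.
have v1 : pr v = 1 by rewrite -[LHS]mulr1 -s1 -prM vs pr1.
by rewrite prM v1 mul1r prX.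
Qed.

(** * Nil clean rings *)

Lemma nil_clean_of_boolean_quot :
    boolean_ring (jacobson_quot R) -> nil_set (jacobson R) -> nil_clean R.
Proof.
move=> B JN x; have [e ee ex] := idempotent_lift x B JN.
exists e, (x - e); split=> //; last by rewrite addrC subrK.
by apply/JN/jacobson_proj_eq.
Qed.

(** Write x - 1 = e + n: then x = e + (1 + n). *)
Lemma clean_of_nil_clean : nil_clean R -> clean R.
Proof.
move=> NC x; have [e [n [ee nn xE]]] := NC (x - 1).
exists e, (1 + n); split=> //; first exact: unit_1addn.
by rewrite addrCA -xE addrC subrK.
Qed.

Lemma nilpotents_sub_jacobson : UJ_ring R -> nilpotents R `<=` jacobson R.
Proof.
move=> /UJ_ringP UJ n /unit_1addn/UJ.
by rewrite prD pr1 -{2}[1]addr0 => /addrI/jacobson_proj_eq0.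
Qed.

Lemma nilpotent_ideal_sub_jacobson :
  two_sided_ideal (nilpotents R) -> nilpotents R `<=` jacobson R.
Proof.
case=> -[N0 NB NM] _; apply: left_ideal_sub_jacobson => // n Nn.
by apply: unit_1addn; rewrite -sub0r; exact: NB.
Qed.

Lemma jacobson_eq_nilpotents :
  nil_clean R -> nilpotents R `<=` jacobson R -> jacobson R = nilpotents R.
Proof.
move=> NC NJ; apply/seteqP; split=> // j Jj.
have [e [n [ee Nn jE]]] := NC j.
have e0 : e = 0.
  apply: jacobson_idempotent0 => //; rewrite -(addrK n e) -jE.
  by have [_ JB _] := jacobson_left_ideal R; apply: JB => //; exact: NJ.
by rewrite jE e0 add0r.
Qed.

Lemma boolean_quot_of_nil_clean :
    nil_clean R -> nilpotents R `<=` jacobson R ->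
  boolean_ring (jacobson_quot R).
Proof.
move=> NC NJ; apply/boolean_quotP => x; have [e [n [ee /NJ nJ ->]]] := NC x.
have n0 : pr n = 0 by apply/jacobson_proj_eq0.
by rewrite prD n0 addr0 -prM ee.
Qed.

Lemma conjugate_nil_clean_of_UJ :
  nil_clean R -> UJ_ring R -> conjugate_nil_clean R.
Proof.
move=> NC UJ; split=> // e f n m ee ff nn mm efE.
apply: conjugate_of_jacobson_proj_eq => //.
have pr0 y : nilpotents R y -> pr y = 0.
  by move=> /(nilpotents_sub_jacobson UJ)/jacobson_proj_eq0.
by have := congr1 pr efE; rewrite !prD (pr0 n) // (pr0 m) // !addr0.
Qed.

(** UJ applied to the unit -1 gives 2 = 0 in the quotient, and x = e + u gives
    [pr x] = [pr e] + 1, which is then idempotent. *)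
Lemma boolean_quot_of_clean_UJ :
  clean R -> UJ_ring R -> boolean_ring (jacobson_quot R).
Proof.
move=> CL /UJ_ringP UJ; apply/boolean_quotP => x.
have N1 : -1 = 1 :> jacobson_quot R.
  rewrite -pr1 -prN; apply: UJ.
  by exists (-1); rewrite mulrNN mulr1.
have [e [u [ee /UJ u1 ->]]] := CL x.
have D2 (y : jacobson_quot R) : y + y = 0.
  by rewrite -{2}[y]mul1r -N1 mulN1r subrr.
by rewrite prD u1 mulrDl mulrDr mul1r mulr1 -prM ee D2 add0r.
Qed.

Lemma nil_jacobson_of_UU :
  boolean_ring (jacobson_quot R) -> UU_ring R -> nil_set (jacobson R).
Proof.
move=> /UJ_of_boolean_quot UJ UU j Jj.
have : units R (1 + j) by rewrite UJ; exists j.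
by rewrite UU => -[n Nn /addrI <-].
Qed.

End Radical.

Theorem theorem3p3 (R : pzRingType) :
  [<-> clean R /\ UJ_ring R /\ nil_set (jacobson R);
       boolean_ring (jacobson_quot R) /\ nil_set (jacobson R);
       nil_clean R /\ UJ_ring R;
       conjugate_nil_clean R /\ UJ_ring R;
       conjugate_nil_clean R /\ two_sided_ideal (nilpotents R);
       boolean_ring (jacobson_quot R) /\ UU_ring R].
Proof.
tfae.
- by move=> [CL [UJ JN]]; split=> //; exact: boolean_quot_of_clean_UJ.
- move=> [B JN]; split; last exact: UJ_of_boolean_quot.
  exact: nil_clean_of_boolean_quot.
- by move=> [NC UJ]; split=> //; exact: conjugate_nil_clean_of_UJ.
- move=> [CNC UJ]; split=> //.
  rewrite -(jacobson_eq_nilpotents (proj1 CNC) (nilpotents_sub_jacobson UJ)).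
  exact: jacobson_two_sided.
- move=> [[NC _] /nilpotent_ideal_sub_jacobson NJ].
  have B := boolean_quot_of_nil_clean NC NJ; split=> //.
  by rewrite /UU_ring -(jacobson_eq_nilpotents NC NJ); exact: UJ_of_boolean_quot.
- move=> [B UU]; have JN := nil_jacobson_of_UU B UU.
  split; last by split=> //; exact: UJ_of_boolean_quot.
  by apply/clean_of_nil_clean/nil_clean_of_boolean_quot.
Qed.
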